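(* Let $a,b,c\in\mathbb{R}$ and let $X=aE_1+bE_2+cE_3\in\mathfrak{sl}_2\mathbb{R}$ be nonzero with $\det X=-(c^2+2ab)=0$. Then the projection $\beta=\pi\circ\gamma$ to $\mathbb{H}^2(-4)$ of the one-parameter subgroup $\gamma(t)=\exp(tX)$ is given by $$x(t)=\frac{\sqrt2\,\{(a+b)t+c(b-a)t^2\}}{2b^2t^2+(1-ct)^2},\qquad y(t)=\frac{1}{2b^2t^2+(1-ct)^2},$$ and it is a horocycle of $\mathbb{H}^2(-4)$, with implicit equation as follows: (1) if $b=0$ (and hence also $c=0$), then $y-1=0$; (2) if $b\neq0$, then $$\Big(x-\frac{c}{b\sqrt2}\Big)^2+\Big(y-\frac{b-a}{2b}\Big)^2=\frac{(b-a)^2}{4b^2}.$$ If moreover $t$ is the arclength parameter of $\exp(tX)$, i.e. $a^2+b^2+c^2=1$, then $|a-b|=1$, the contact angle $\sigma$ of $\exp(tX)$ is $\pi/4$ or $3\pi/4$, the curve $\exp(tX)$ is a contact magnetic curve of strength $q\neq 0$ if and only if $q=2\sqrt2\,\mathrm{sgn}(a-b)$, and for this $q$ one has $q-2\cos\sigma=\sqrt2\,\mathrm{sgn}(a-b)$ and the signed curvature of $\beta$ is $2\,\mathrm{sgn}(a-b)$.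
   Context: The basis of $\mathfrak{sl}_2\mathbb{R}$ is $$E_1=\sqrt2\begin{pmatrix}0&1\\0&0\end{pmatrix},\quad E_2=\sqrt2\begin{pmatrix}0&0\\1&0\end{pmatrix},\quad E_3=\begin{pmatrix}1&0\\0&-1\end{pmatrix}.$$ Coordinates and metric: every element of $\mathrm{SL}_2\mathbb{R}$ is written uniquely as $$\begin{pmatrix}1&x\\0&1\end{pmatrix}\begin{pmatrix}\sqrt y&0\\0&1/\sqrt y\end{pmatrix}\begin{pmatrix}\cos\theta&\sin\theta\\-\sin\theta&\cos\theta\end{pmatrix},\quad x\in\mathbb{R},\ y>0,\ \theta\in\mathbb{R}/2\pi\mathbb{Z},$$ and $(x,y,\theta)$ are used as global coordinates. $\mathrm{SL}_2\mathbb{R}$ carries the left invariant Riemannian metric $$g=\frac{dx^2+dy^2}{4y^2}+\Big(d\theta+\frac{dx}{2y}\Big)^2 ,$$ for which $\{E_1,E_2,E_3\}$ (as left invariant vector fields) is orthonormal. The frame $\epsilon_1=2y\,\partial_x-\partial_\theta$, $\epsilon_2=2y\,\partial_y$, $\epsilon_3=\partial_\theta$ is $g$-orthonormal. The canonical Sasakian structure is $(\varphi,\xi,\eta,g)$ with $\eta=d\theta+\frac{dx}{2y}$, $\xi=\epsilon_3=\frac1{\sqrt2}(E_1-E_2)$, $\varphi\epsilon_1=\epsilon_2$, $\varphi\epsilon_2=-\epsilon_1$, $\varphi\epsilon_3=0$. A contact magnetic curve of strength $q$ is a curve $\gamma$ satisfying $\nabla_{\gamma'}\gamma'=q\,\varphi\gamma'$,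 where $\nabla$ is the Levi-Civita connection of $g$. The contact angle $\sigma\in[0,\pi]$ of an arclength parametrized curve is defined by $\cos\sigma=g(\gamma',\xi)$. $\mathbb{H}^2(-4)$ is the upper half plane $\{(x,y):y>0\}$ with metric $\bar g=\frac{dx^2+dy^2}{4y^2}$ and complex structure $J\partial_x=\partial_y$, $J\partial_y=-\partial_x$; $\pi(x,y,\theta)=(x,y)$. A horocycle is a horizontal line $y=\text{const}>0$, or a Euclidean circle tangent to the boundary line $y=0$ with the tangency point removed. The signed curvature of a regular curve $\beta$ is the function $\kappa_\beta$ with $\overline\nabla_{\overline T}\overline T=\kappa_\beta J\overline T$, where $\overline T$ is the unit tangent vector of $\beta$ and $\overline\nabla$ is the Levi-Civita connection of $\bar g$. *)

(* Defs.v *)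
From HB Require Import structures.
From mathcomp Require Import all_boot all_order all_algebra.
From mathcomp Require Import all_classical all_reals all_analysis.
From mathcomp Require Import ring lra.

Set Implicit Arguments.
Unset Strict Implicit.
Unset Printing Implicit Defensive.

Import Order.TTheory GRing.Theory Num.Theory.
Import numFieldNormedType.Exports.

Local Open Scope classical_set_scope.
Local Open Scope ring_scope.

Section Vectors.
Variable R : realType.

Definition mx2 (a b c d : R) : 'M[R]_2 :=
  \matrix_(i, j) (if i == 0 then if j == 0 then a else b
                  else if j == 0 then c else d).

Definition vec2 (x y : R) : 'rV[R]_2 := \row_i [:: x; y]`_i.

Definition vec3 (x y z : R) : 'rV[R]_3 := \row_i [:: x; y; z]`_i.

End Vectors.

(* A Riemannian metric on an open subset of R^n is a function [g] sending a
   point and two tangent vectors, given by their components in the coordinate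
   frame, to their scalar product. *)
Section LeviCivita.
Variables (R : realType) (n : nat).
Variable g : 'rV[R]_n -> 'rV[R]_n -> 'rV[R]_n -> R.

Definition gram (p : 'rV[R]_n) : 'M[R]_n :=
  \matrix_(i, j) g p (delta_mx 0 i) (delta_mx 0 j).

Definition dgram (k i j : 'I_n) (p : 'rV[R]_n) : R :=
  'D_(delta_mx 0 k) (fun z => gram z i j) p.

(* Gamma^k_ij
   = 1/2 sum_l g^kl (partial_i g_jl + partial_j g_il - partial_l g_ij) *)
Definition christoffel (p : 'rV[R]_n) (k i j : 'I_n) : R :=
  2^-1 * \sum_l invmx (gram p) k l
           * (dgram i j l p + dgram j i l p - dgram l i j p).

(* Levi-Civita covariant derivative along the curve [c] of the vector field [V]
   along [c]. *)
Definition covderiv (c V : R -> 'rV[R]_n) (t : R) : 'rV[R]_n :=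
  derive1 V t + \row_k \sum_i \sum_j
    christoffel (c t) k i j * derive1 c t 0 i * V t 0 j.

Definition gnorm (p v : 'rV[R]_n) : R := Num.sqrt (g p v v).

Lemma gram_sym p i j :
  (forall p v w, g p v w = g p w v) -> gram p i j = gram p j i.
Proof. by move=> g_sym; rewrite !mxE g_sym. Qed.

Lemma dgram_sym p k i j :
  (forall p v w, g p v w = g p w v) -> dgram k i j p = dgram k j i p.
Proof.
by move=> g_sym; congr ('D_ _ _ _); apply: funext => z; exact: gram_sym.
Qed.

Lemma christoffel_torsion_free p k i j :
  (forall p v w, g p v w = g p w v) -> christoffel p k i j = christoffel p k j i.
Proof.
move=> g_sym; congr (_ * _); apply: eq_bigr => l _; congr (_ * _).
by rewrite [dgram i j l p + _]addrC (dgram_sym _ l i j g_sym).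
Qed.

Lemma christoffel_lower p m i j : gram p \in unitmx ->
  \sum_k gram p m k * christoffel p k i j =
  2^-1 * (dgram i j m p + dgram j i m p - dgram m i j p).
Proof.
move=> Gu; pose u := \col_l (dgram i j l p + dgram j i l p - dgram l i j p).
transitivity (2^-1 * (gram p *m (invmx (gram p) *m u)) m 0); last first.
  by rewrite mulKVmx// mxE.
rewrite mxE mulr_sumr; apply: eq_bigr => k _.
rewrite mulrCA; congr (_ * (_ * _)); rewrite mxE.
by apply: eq_bigr => l _; rewrite [u _ _]mxE.
Qed.

Lemma christoffel_metric p k i j :
  (forall p v w, g p v w = g p w v) -> gram p \in unitmx ->
  dgram k i j p = \sum_l gram p j l * christoffel p l k i
                + \sum_l gram p i l * christoffel p l k j.
Proof.
move=> g_sym Gu; rewrite !christoffel_lower// -mulrDr.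
rewrite (dgram_sym p k j i g_sym) (dgram_sym p i k j g_sym).
by rewrite (dgram_sym p j k i g_sym); field; rewrite ?pnatr_eq0.
Qed.

End LeviCivita.

Section SL2.
Variable R : realType.

Definition E1 : 'M[R]_2 := Num.sqrt 2 *: mx2 0 1 0 0.
Definition E2 : 'M[R]_2 := Num.sqrt 2 *: mx2 0 0 1 0.
Definition E3 : 'M[R]_2 := mx2 1 0 0 (-1).

Definition expmx (A : 'M[R]_2) : 'M[R]_2 :=
  limn (series (fun n => n`!%:R^-1 *: A ^+ n)).

(* The element of SL_2(R) with coordinates p = (x, y, theta), 0 < y; here theta
   is a real number, and only its class modulo 2 pi matters. *)
Definition iwasawa (p : 'rV[R]_3) : 'M[R]_2 :=
  let x := p 0 0 in let y := p 0 1 in let theta := p 0 2 in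
  mx2 1 x 0 1 *m mx2 (Num.sqrt y) 0 0 (Num.sqrt y)^-1
  *m mx2 (cos theta) (sin theta) (- sin theta) (cos theta).

Definition projH (M : 'M[R]_2) : 'rV[R]_2 :=
  xget 0 [set z : 'rV[R]_2 | 0 < z 0 1 /\
                  exists theta, M = iwasawa (vec3 (z 0 0) (z 0 1) theta)].

Definition eta (p v : 'rV[R]_3) : R := v 0 2 + v 0 0 / (2 * p 0 1).

Definition gSL (p v w : 'rV[R]_3) : R :=
  (v 0 0 * w 0 0 + v 0 1 * w 0 1) / (4 * p 0 1 ^+ 2) + eta p v * eta p w.

Definition eps1 (p : 'rV[R]_3) : 'rV[R]_3 := vec3 (2 * p 0 1) 0 (-1).
Definition eps2 (p : 'rV[R]_3) : 'rV[R]_3 := vec3 0 (2 * p 0 1) 0.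
Definition xi (p : 'rV[R]_3) : 'rV[R]_3 := vec3 0 0 1.

(* The linear map eps1 |-> eps2, eps2 |-> - eps1, xi |-> 0, written with the
   orthonormality of the frame (eps1, eps2, xi). *)
Definition phi (p v : 'rV[R]_3) : 'rV[R]_3 :=
  gSL p v (eps1 p) *: eps2 p - gSL p v (eps2 p) *: eps1 p.

Lemma iwasawaE (p : 'rV[R]_3) :
  let x := p 0 0 in let r := Num.sqrt (p 0 1) in let th := p 0 2 in
  iwasawa p = mx2 (r * cos th - x * (r^-1 * sin th))
                  (r * sin th + x * (r^-1 * cos th))
                  (- (r^-1 * sin th)) (r^-1 * cos th).
Proof.
apply/matrixP => i j; rewrite !mxE !big_ord_recl !big_ord0 !mxE.
rewrite !big_ord_recl !big_ord0 !mxE /=.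
by case: ifP => _; case: ifP => _; ring.
Qed.

Lemma iwasawa_row2 (p : 'rV[R]_3) : 0 < p 0 1 ->
  iwasawa p 1 0 ^+ 2 + iwasawa p 1 1 ^+ 2 = (p 0 1)^-1.
Proof.
move=> y0; rewrite iwasawaE !mxE /= sqrrN !exprMn -mulrDr addrC cos2Dsin2 mulr1.
by rewrite exprVn sqr_sqrtr// ltW.
Qed.

Lemma iwasawa_inj (p q : 'rV[R]_3) : 0 < p 0 1 -> 0 < q 0 1 ->
  iwasawa p = iwasawa q ->
  [/\ p 0 0 = q 0 0, p 0 1 = q 0 1, cos (p 0 2) = cos (q 0 2) &
      sin (p 0 2) = sin (q 0 2)].
Proof.
move=> p0 q0 pq; have yE : p 0 1 = q 0 1.
  by apply: invr_inj; rewrite -!iwasawa_row2// pq.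
have r0 : Num.sqrt (q 0 1) != 0 by rewrite sqrtr_eq0 -ltNge.
have /matrixP E := pq; rewrite !iwasawaE yE in E.
have := E 1 1; rewrite !mxE /= => /(mulfI (invr_neq0 r0)) cE.
have := E 1 0; rewrite !mxE /= => /oppr_inj/(mulfI (invr_neq0 r0)) sE.
split=> //; have := E 0 1; rewrite !mxE /= cE sE => /addrI xc.
have := E 0 0; rewrite !mxE /= cE sE => /addrI/oppr_inj xs.
have : (p 0 0 - q 0 0) * (cos (q 0 2) ^+ 2 + sin (q 0 2) ^+ 2) = 0.
  apply: (mulfI (invr_neq0 r0)); rewrite mulr0.
  transitivity (cos (q 0 2) * (p 0 0 * ((Num.sqrt (q 0 1))^-1 * cos (q 0 2))
      - q 0 0 * ((Num.sqrt (q 0 1))^-1 * cos (q 0 2)))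
    + sin (q 0 2) * (p 0 0 * ((Num.sqrt (q 0 1))^-1 * sin (q 0 2))
      - q 0 0 * ((Num.sqrt (q 0 1))^-1 * sin (q 0 2)))); first by ring.
  by rewrite xc xs !subrr !mulr0 addr0.
by rewrite cos2Dsin2 mulr1 => /eqP; rewrite subr_eq0 => /eqP.
Qed.

Lemma projH_iwasawa x y theta : 0 < y ->
  projH (iwasawa (vec3 x y theta)) = vec2 x y.
Proof.
move=> y0; rewrite /projH; apply: xget_unique => [|z [z0 [th' E]]].
  by rewrite /= !mxE /=; split=> //; exists theta.
have [||] := iwasawa_inj _ _ E; rewrite ?mxE//= => xE yE _ _.
apply/rowP => i; rewrite mxE xE yE.
by case: i => -[|[|//]] i2 /=; congr (z 0 _); apply: val_inj.
Qed.

Lemma gSL_frame (p : 'rV[R]_3) : 0 < p 0 1 ->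
  [/\ gSL p (eps1 p) (eps1 p) = 1, gSL p (eps2 p) (eps2 p) = 1,
      gSL p (xi p) (xi p) = 1, gSL p (eps1 p) (eps2 p) = 0 &
      gSL p (eps1 p) (xi p) = 0 /\ gSL p (eps2 p) (xi p) = 0].
Proof.
move=> /lt0r_neq0 y0; rewrite /gSL /eta /eps1 /eps2 /xi !mxE /=.
by do !split; field; rewrite ?y0.
Qed.

Lemma phi_frame (p : 'rV[R]_3) : 0 < p 0 1 ->
  [/\ phi p (eps1 p) = eps2 p, phi p (eps2 p) = - eps1 p & phi p (xi p) = 0].
Proof.
move=> /gSL_frame[g11 g22 _ g12 [g13 g23]].
have g_sym v w : gSL p v w = gSL p w v.
  by rewrite /gSL mulrC (mulrC (eta p v)) (mulrC (v 0 0)) (mulrC (v 0 1)) mulrC.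
rewrite /phi !(g_sym _ (eps1 _)) !(g_sym _ (eps2 _)) g11 g22 g13 g23.
by rewrite g_sym g12 !(scale1r, scale0r, subr0, sub0r).
Qed.

(* [c] is an expression of [gamma] in the coordinates (x, y, theta), theta being
   lifted from R / 2 pi Z to R; it is determined by [gamma] up to the addition
   of a constant of 2 pi Z to theta. *)
Definition coord_lift (gamma : R -> 'M[R]_2) (c : R -> 'rV[R]_3) : Prop :=
  forall t, [/\ 0 < c t 0 1, iwasawa (c t) = gamma t,
                derivable c t 1 & derivable (derive1 c) t 1].

Definition unit_speed (gamma : R -> 'M[R]_2) : Prop :=
  exists2 c, coord_lift gamma c &
    forall t, gnorm gSL (c t) (derive1 c t) = 1.

Definition contact_angle (gamma : R -> 'M[R]_2) (sigma : R -> R) : Prop :=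
  exists2 c, coord_lift gamma c &
    forall t, 0 <= sigma t <= pi /\
              cos (sigma t) = gSL (c t) (derive1 c t) (xi (c t)).

Definition contact_magnetic (q : R) (gamma : R -> 'M[R]_2) : Prop :=
  exists2 c, coord_lift gamma c &
    forall t, covderiv gSL c (derive1 c) t = q *: phi (c t) (derive1 c t).

End SL2.

Section HyperbolicPlane.
Variable R : realType.

Definition gH (z v w : 'rV[R]_2) : R :=
  (v 0 0 * w 0 0 + v 0 1 * w 0 1) / (4 * z 0 1 ^+ 2).

Definition Jc (v : 'rV[R]_2) : 'rV[R]_2 := vec2 (- v 0 1) (v 0 0).

Definition horocycle (S : set 'rV[R]_2) : Prop :=
  (exists2 h, 0 < h & S = [set z : 'rV[R]_2 | z 0 1 = h]) \/
  (exists x0 r, 0 < r /\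
     S = [set z : 'rV[R]_2 | 0 < z 0 1 /\
                  (z 0 0 - x0) ^+ 2 + (z 0 1 - r) ^+ 2 = r ^+ 2]).

Definition unit_tangent (beta : R -> 'rV[R]_2) (t : R) : 'rV[R]_2 :=
  (gnorm gH (beta t) (derive1 beta t))^-1 *: derive1 beta t.

(* As T = beta' / |beta'|, the derivative of T in the direction T is the
   covariant derivative of T along beta divided by |beta'|. *)
Definition signed_curvature (beta : R -> 'rV[R]_2) (kappa : R -> R) : Prop :=
  let T := unit_tangent beta in
  forall t, [/\ 0 < beta t 0 1, derivable beta t 1, derive1 beta t != 0,
                derivable T t 1 &
                (gnorm gH (beta t) (derive1 beta t))^-1 *: covderiv gH beta T t
                = kappa t *: Jc (T t)].

End HyperbolicPlane.

(* Main.v *)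
Require Import Defs.
From mathcomp Require Import all_boot all_order all_algebra.
From mathcomp Require Import all_classical all_reals all_analysis.
From mathcomp Require Import ring lra.
Import Order.TTheory GRing.Theory Num.Theory.
Import numFieldNormedType.Exports.
Local Open Scope classical_set_scope.
Local Open Scope ring_scope.

Set Implicit Arguments.
Unset Strict Implicit.
Unset Printing Implicit Defensive.

(** Since X has trace and determinant 0, X ^+ 2 = 0 by Cayley-Hamilton and
    exp (t X) = 1 + t X ([expmx_sq0]).  With A = sqrt 2 a and B = sqrt 2 b this
    is the matrix with rows (1 + c t, A t) and (B t, 1 - c t), and det X = 0
    reads A B = - c ^ 2; as X is nonzero, this excludes A = B.  The Iwasawa
    coordinates of a matrix of determinant 1 are read off its two rows
    ([iwasawaP]): 1 / y is the squared length of the bottom row and x / y its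
    scalar product with the top row; this gives the formulas for the projection.

    Everything metric is computed in the orthonormal frame (eps1, eps2, xi).
    The velocity of the curve has components (u1, u2, u3) with u3 = (A - B) / 2
    constant, u1 = u3 + B y, and u1 ^ 2 + u2 ^ 2 = u3 ^ 2, because u1 + i u2 is
    turned by twice the angle theta.  Hence the squared speed is 2 u3 ^ 2,
    which equals both (a - b) ^ 2 and a ^ 2 + b ^ 2 + c ^ 2.  At unit speed the
    cosine of the contact angle is u3 = (a - b) / sqrt 2, which is one of
    +1 / sqrt 2 and -1 / sqrt 2.  As theta' = - B y, the derivatives are
    u1' = 2 B y u2 and u2' = - 2 B y u1.  Inserting them into the connection in
    the frame ([covderiv_frameSL]) shows that the acceleration of gamma is
    4 u3 phi gamma' ([covderiv_lift]); as phi gamma' does not vanish, q = 4 u3 is the only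
    possible strength.  The same derivatives in the half plane give the signed
    curvature 2 sg u3 ([signed_curvature_nil]).

    The lift theta of the angle is not unique, so the frame components are shown
    to be the same for every lift ([lift_frameSL]), and one global smooth lift is
    exhibited ([coord_lift_nil]).

    If B = 0, the horocycle is the line y = 1.  Otherwise, with cc = c / B,
    one has x - cc = y w and w ^ 2 + 1 = (B - A) / (B y) for an affine bijection
    w of the time line.  Eliminating w gives the equation of the circle, and
    every point of the circle off the boundary line is reached because w takes
    every real value ([range_nil_circle]). *)

(** * Matrices and one-variable calculus *)

(** The partial sums of the exponential series are constant from the second
    term on. *)
Lemma expmx_sq0 (R : realType) (N : 'M[R]_2) : N ^+ 2 = 0 -> expmx N = 1 + N.
Proof.
move=> N2; rewrite /expmx.
have SE n : series (fun k => k`!%:R^-1 *: N ^+ k) n.+2 = 1 + N.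
  rewrite /series /= !big_nat_recl//= big1 ?addr0 => [|i _].
    by rewrite !fact0 expr0 expr1 factS fact0 invr1 !scale1r.
  by rewrite -[X in N ^+ X]add2n exprD N2 mul0r scaler0.
apply: lim_near_cst; first exact: norm_hausdorff.
by near=> n; rewrite -(SE n.-2); congr series; near: n; exists 2%N => // -[|[]].
Unshelve. all: by end_near.
Qed.

Lemma invmx_eq (F : fieldType) (n : nat) (M N : 'M[F]_n) :
  M *m N = 1%:M -> invmx M = N.
Proof.
by move=> MN; have [Mu _] := mulmx1_unit MN; rewrite -[RHS](mulKmx Mu) MN mulmx1.
Qed.

(** A directional derivative of a function of one coordinate is a derivative on
    the line, since the difference quotients are literally the same. *)
Lemma derive_coord (R : realType) (n : nat) (l : 'I_n) (h : R -> R) (dh : R)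
    (p v : 'rV[R]_n) :
  is_derive (p 0 l) 1 h dh ->
  'D_v (fun z : 'rV[R]_n => h (z 0 l)) p = v 0 l * dh.
Proof.
move=> hd; have [h_der hE] := hd.
transitivity ('D_(v 0 l) h (p 0 l)).
  rewrite /derive; set u := (X in lim (X @ _)); set w := (X in _ = lim (X @ _)).
  suff -> : u = w by [].
  by apply: funext => e; rewrite /u /w /= !mxE.
move/derivable1_diffP: (h_der) => h_diff.
by rewrite deriveE// deriv1E// derive1E hE.
Qed.

(** The derivation rules for sum, product and inverse, on functions written
    pointwise. *)
Section Calculus.
Variables (R : realType) (f g : R -> R) (t df dg : R).
Hypotheses (fd : is_derive t 1 f df) (gd : is_derive t 1 g dg).

Lemma is_derive_add : is_derive t 1 (fun s => f s + g s) (df + dg).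
Proof. exact: is_deriveD. Qed.

Lemma is_derive_mul : is_derive t 1 (fun s => f s * g s) (f t * dg + g t * df).
Proof. exact: is_deriveM. Qed.

Lemma is_derive_inv : f t != 0 ->
  is_derive t 1 (fun s => (f s)^-1) (- (f t) ^- 2 * df).
Proof. by move=> f0; exact: is_deriveV. Qed.
End Calculus.

Lemma is_derive_affine (R : realType) (p q t : R) :
  is_derive t 1 (fun s => p + q * s) q.
Proof.
have -> : (fun s => p + q * s) = horner (q *: 'X + p%:P).
  by apply: funext => s; rewrite !hornerE; ring.
by apply: is_derive_eq; rewrite !poly.derivE !hornerE; ring.
Qed.

Lemma is_derive_rV (R : realType) (n : nat) (v : R -> 'rV[R]_n) (t : R)
    (dv : 'rV[R]_n) :
  (forall i, is_derive t 1 (fun s => v s 0 i) (dv 0 i)) <-> is_derive t 1 v dv.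
Proof.
split=> [dvE|[vder <-] i].
  have vder : derivable v t 1.
    by apply/derivable_mxP => i j; rewrite ord1; have [] := dvE j.
  apply: DeriveDef => //; rewrite derive_mx//; apply/rowP => i.
  by rewrite mxE; have [] := dvE i.
have /derivable_mxP vder' := vder.
by apply: DeriveDef => //; rewrite derive_mx// mxE.
Qed.

Lemma derive1_is_derive (R : realType) (V : normedModType R) (v : R -> V)
    (t : R) (dv : V) :
  is_derive t 1 v dv -> derive1 v t = dv.
Proof. by move=> [_ <-]; rewrite derive1E. Qed.

Lemma sin_atan (R : realType) (x : R) : sin (atan x) = x / Num.sqrt (1 + x ^+ 2).
Proof.
rewrite -cos_atan -{2}(atanK x) /tan divfK// cos_atan invr_eq0 gt_eqF//.
by rewrite sqrtr_gt0 (ltr_pwDl ltr01 (sqr_ge0 x)).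
Qed.

Lemma cos_piquarter (R : realType) : cos (pi / 4 : R) = Num.sqrt 2 / 2.
Proof.
rewrite -atan1 cos_atan expr1n -[1 + 1]/(2 : R).
have s0 : Num.sqrt (2 : R) != 0 by rewrite sqrtr_eq0 -ltNge ltr0n.
by rewrite -[X in _ = _ / X](@sqr_sqrtr R 2) ?ler0n//; field.
Qed.

Lemma is_derive_mulVXn (R : realType) (k y : R) n : y != 0 ->
  is_derive y 1 (fun s => k * s ^- n) (- (k * n%:R * y ^- n.+1)).
Proof.
move=> y0; have yn0 : y ^+ n != 0 by rewrite expf_neq0.
have Xd : is_derive y 1 (fun s : R => s ^+ n) (n%:R * y ^+ n.-1).
  have -> : (fun s : R => s ^+ n) = id ^+ n :> (R -> R) by rewrite exprfctE.
  by apply: is_derive_eq; rewrite /= /GRing.scale /= mulr1.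
have := is_derive_mul (is_derive_cst k y 1) (is_derive_inv Xd yn0).
move/is_derive_eq; apply; rewrite /cst mulr0 addr0.
case: n {Xd} yn0 => [|n] yn0; first by rewrite !(mul0r, mulr0) oppr0.
by rewrite exprSr exprS /= !exprS; field; rewrite y0 expf_neq0.
Qed.

(** * Levi-Civita connection of the metric on SL(2, R) *)

Lemma christoffelE {R : realType} {n : nat}
    {g : 'rV[R]_n -> 'rV[R]_n -> 'rV[R]_n -> R}
    (M : 'M[R]_n) (dG : 'I_n -> 'I_n -> 'I_n -> R) (p : 'rV[R]_n) k i j :
  gram g p *m M = 1%:M ->
  (forall k i j, dgram g k i j p = dG k i j) ->
  christoffel g p k i j =
    2^-1 * \sum_l M k l * (dG i j l + dG j i l - dG l i j).
Proof.
move=> MG dGE; rewrite /christoffel (invmx_eq MG).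
by congr (_ * _); apply: eq_bigr => l _; rewrite !dGE.
Qed.

Section SL2Connection.
Variable R : realType.
Implicit Types p v w : 'rV[R]_3.

(** Every entry of the Gram matrix is a monomial in 1 / y, so one rule
    differentiates them all; the exponent counts the indices that are not
    theta. *)
Definition gSLcoef (i j : 'I_3) : R :=
  nth 0 (nth [::] [:: [:: 2^-1; 0; 2^-1]; [:: 0; 4^-1; 0]; [:: 2^-1; 0; 1]] i) j.
Definition gSLexp (i j : 'I_3) : nat := (i < 2) + (j < 2).

Lemma gram_gSL p i j :
  gram (@gSL R) p i j = gSLcoef i j * p 0 1 ^- gSLexp i j.
Proof.
rewrite mxE /gSL /eta !mxE /gSLcoef /gSLexp !invfM -!exprVn.
move: (p 0 1)^-1 => u.
by case: i => -[|[|[|//]]] hi; case: j => -[|[|[|//]]] hj /=; field.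
Qed.

Lemma dgram_gSL p k i j : p 0 1 != 0 ->
  dgram (@gSL R) k i j p =
  (k == 1)%:R * - (gSLcoef i j * (gSLexp i j)%:R * p 0 1 ^- (gSLexp i j).+1).
Proof.
move=> y0; rewrite /dgram.
under eq_fun do rewrite gram_gSL.
rewrite (derive_coord _ (is_derive_mulVXn _ _ y0)) mxE eqxx /=.
by rewrite eq_sym.
Qed.

Definition gSLinv (y : R) : 'M[R]_3 := \matrix_(i, j)
  nth 0 (nth [::] [:: [:: 4 * y ^+ 2; 0; - 2 * y]; [:: 0; 4 * y ^+ 2; 0];
                     [:: - 2 * y; 0; 2]] i) j.

Lemma gram_gSL_inv p : p 0 1 != 0 -> gram (@gSL R) p *m gSLinv (p 0 1) = 1%:M.
Proof.
move=> y0; apply/matrixP => i j; rewrite mxE !big_ord_recl big_ord0 !gram_gSL.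
rewrite !mxE /gSLcoef /gSLexp.
by case: i => -[|[|[|//]]] hi; case: j => -[|[|[|//]]] hj /=; field.
Qed.

(** Only y-derivatives of the metric are nonzero, so the Christoffel symbols
    enter through the two symmetric products S and T alone. *)
Lemma covderiv_gSL (c V : R -> 'rV[R]_3) (t : R) : c t 0 1 != 0 ->
  let y := c t 0 1 in let v := derive1 c t in let w := V t in
  let S := v 0 0 * w 0 1 + v 0 1 * w 0 0 in
  let T := v 0 1 * w 0 2 + v 0 2 * w 0 1 in
  covderiv (@gSL R) c V t = derive1 V t +
    vec3 (- (3 / (2 * y)) * S - T)
         (v 0 0 * w 0 2 + v 0 2 * w 0 0
          + (2 * v 0 0 * w 0 0 - v 0 1 * w 0 1) / y)
         (S / (2 * y ^+ 2) + T / (2 * y)).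
Proof.
move=> y0 y v w S T; rewrite /covderiv; congr (_ + _); apply/rowP => k.
rewrite [LHS]mxE.
under eq_bigr => i _ do under eq_bigr => j _ do
  rewrite (christoffelE k i j (gram_gSL_inv y0) (fun k i j => dgram_gSL k i j y0)).
rewrite -/y -/v -/w /S /T !big_ord_recl !big_ord0 !mxE.
have -> : lift ord0 (ord0 : 'I_2) = 1 :> 'I_3 by apply: val_inj.
have -> : lift ord0 (lift ord0 (ord0 : 'I_1)) = 2 :> 'I_3 by apply: val_inj.
rewrite /gSLcoef /gSLexp /=.
by case: k => -[|[|[|//]]] hk /=; field.
Qed.

End SL2Connection.

(** * The orthonormal frame *)

Section SL2Frame.
Variable R : realType.
Implicit Types p : 'rV[R]_3.

Definition frameSL p (u1 u2 u3 : R) : 'rV[R]_3 :=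
  u1 *: eps1 p + u2 *: eps2 p + u3 *: xi p.

Lemma frameSLE p u1 u2 u3 :
  frameSL p u1 u2 u3 = vec3 (2 * p 0 1 * u1) (2 * p 0 1 * u2) (u3 - u1).
Proof.
apply/rowP => i; rewrite !mxE.
by case: i => -[|[|[|//]]] hi /=; ring.
Qed.

Lemma gSL_frameSL p u1 u2 u3 v1 v2 v3 : p 0 1 != 0 ->
  gSL p (frameSL p u1 u2 u3) (frameSL p v1 v2 v3) = u1 * v1 + u2 * v2 + u3 * v3.
Proof. by move=> y0; rewrite !frameSLE /gSL /eta !mxE /=; field. Qed.

Lemma xi_frameSL p : xi p = frameSL p 0 0 1.
Proof. by rewrite /frameSL !scale0r !add0r scale1r. Qed.

Lemma phi_frameSL p u1 u2 u3 : p 0 1 != 0 ->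
  phi p (frameSL p u1 u2 u3) = frameSL p (- u2) u1 0.
Proof.
move=> y0; rewrite /phi.
have -> : eps1 p = frameSL p 1 0 0.
  by rewrite /frameSL !scale0r !addr0 scale1r.
have -> : eps2 p = frameSL p 0 1 0.
  by rewrite /frameSL !scale0r !addr0 scale1r add0r.
rewrite !gSL_frameSL// !frameSLE; apply/rowP => i; rewrite !mxE.
by case: i => -[|[|[|//]]] hi /=; ring.
Qed.

Lemma frameSL_inj p u1 u2 u3 v1 v2 v3 : p 0 1 != 0 ->
  frameSL p u1 u2 u3 = frameSL p v1 v2 v3 -> [/\ u1 = v1, u2 = v2 & u3 = v3].
Proof.
move=> y0; rewrite !frameSLE => /rowP E.
have y2 : 2 * p 0 1 != 0 by rewrite mulf_neq0// pnatr_eq0.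
have := E 0; have := E 1; have := E 2; rewrite !mxE /= => E2 E1 E0.
have u1E := mulfI y2 E0; split=> //; first exact: mulfI y2 _ _ E1.
by move: E2; rewrite u1E => /addIr.
Qed.

(** The quadratic terms come from the bracket of eps1 and eps2, which is
    - 2 (eps1 + xi) and is the only nonzero bracket of the frame. *)
Lemma covderiv_frameSL (c : R -> 'rV[R]_3) (u1 u2 u3 : R -> R)
    (t du1 du2 du3 : R) :
  c t 0 1 != 0 -> derivable c t 1 ->
  (forall s, derive1 c s = frameSL (c s) (u1 s) (u2 s) (u3 s)) ->
  is_derive t 1 u1 du1 -> is_derive t 1 u2 du2 -> is_derive t 1 u3 du3 ->
  derivable (derive1 c) t 1 /\
  covderiv (@gSL R) c (derive1 c) t =
    frameSL (c t) (du1 - 2 * u2 t * (u1 t + u3 t))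
                  (du2 + 2 * u1 t * (u1 t + u3 t)) du3.
Proof.
move=> y0 c_der c'E u1d u2d u3d.
have cE : is_derive t 1 c (derive1 c t).
  by apply: DeriveDef; rewrite // derive1E.
have /is_derive_rV/(_ 1) := cE.
rewrite c'E frameSLE mxE /= => yd.
have c''E : is_derive t 1 (derive1 c)
    (vec3 (4 * c t 0 1 * u2 t * u1 t + 2 * c t 0 1 * du1)
          (4 * c t 0 1 * u2 t * u2 t + 2 * c t 0 1 * du2) (du3 - du1)).
  apply/is_derive_rV => i.
  have -> : (fun s => derive1 c s 0 i) = fun s =>
     vec3 (2 * c s 0 1 * u1 s) (2 * c s 0 1 * u2 s) (u3 s - u1 s) 0 i.
    by apply: funext => s; rewrite c'E frameSLE.
  case: i => -[|[|[|//]]] hi /=; under eq_fun do rewrite mxE /=; rewrite mxE /=.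
  - have /is_derive_eq :=
      is_derive_mul (is_derive_mul (is_derive_cst (2 : R) t 1) yd) u1d.
    by apply; rewrite /cst; ring.
  - have /is_derive_eq :=
      is_derive_mul (is_derive_mul (is_derive_cst (2 : R) t 1) yd) u2d.
    by apply; rewrite /cst; ring.
  - exact: is_deriveB.
split; first by case: c''E.
rewrite covderiv_gSL// (derive1_is_derive c''E) !c'E !frameSLE.
apply/rowP => i; rewrite !mxE.
by case: i => -[|[|[|//]]] hi /=; field.
Qed.

End SL2Frame.

(** * Levi-Civita connection of the half plane *)

Section HyperbolicConnection.
Variable R : realType.

Lemma gram_gH (p : 'rV[R]_2) i j :
  gram (@gH R) p i j = (4^-1 * (i == j)%:R) * p 0 1 ^- 2.
Proof.
rewrite mxE /gH !mxE invfM -!exprVn; move: (p 0 1)^-1 => u.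
by case: i => -[|[|//]] hi; case: j => -[|[|//]] hj /=; field.
Qed.

Lemma dgram_gH (p : 'rV[R]_2) k i j : p 0 1 != 0 ->
  dgram (@gH R) k i j p =
  (k == 1)%:R * - (4^-1 * (i == j)%:R * 2 * p 0 1 ^- 3).
Proof.
move=> y0; rewrite /dgram.
under eq_fun do rewrite gram_gH.
rewrite (derive_coord _ (is_derive_mulVXn _ _ y0)) mxE eqxx /=.
by rewrite eq_sym.
Qed.

Lemma gram_gH_inv (p : 'rV[R]_2) : p 0 1 != 0 ->
  gram (@gH R) p *m (4 * p 0 1 ^+ 2)%:M = 1%:M.
Proof.
move=> y0; apply/matrixP => i j.
by rewrite mul_mx_scalar [LHS]mxE gram_gH [RHS]mxE; field.
Qed.

Lemma covderiv_gH (c V : R -> 'rV[R]_2) (t : R) : c t 0 1 != 0 ->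
  let y := c t 0 1 in let v := derive1 c t in let w := V t in
  covderiv (@gH R) c V t = derive1 V t +
    vec2 (- (v 0 0 * w 0 1 + v 0 1 * w 0 0) / y)
         ((v 0 0 * w 0 0 - v 0 1 * w 0 1) / y).
Proof.
move=> y0 y v w; rewrite /covderiv; congr (_ + _); apply/rowP => k.
rewrite [LHS]mxE.
under eq_bigr => i _ do under eq_bigr => j _ do
  rewrite (christoffelE k i j (gram_gH_inv y0) (fun k i j => dgram_gH k i j y0)).
rewrite -/y -/v -/w !big_ord_recl !big_ord0 !mxE.
have -> : lift ord0 (ord0 : 'I_1) = 1 :> 'I_2 by apply: val_inj.
by case: k => -[|[|//]] hk /=; field.
Qed.

Lemma gnorm_gH (p : 'rV[R]_2) (u1 u2 : R) : p 0 1 != 0 ->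
  Defs.gnorm (@gH R) p (vec2 (2 * p 0 1 * u1) (2 * p 0 1 * u2))
  = Num.sqrt (u1 ^+ 2 + u2 ^+ 2).
Proof.
by move=> y0; rewrite /Defs.gnorm /gH !mxE /=; congr Num.sqrt; field.
Qed.
End HyperbolicConnection.

(** * Iwasawa coordinates *)

(** The rotation factor disappears from the scalar products of the rows, which
    gives x and y; the bottom row then gives theta. *)
Lemma iwasawaP (R : realType) (p : 'rV[R]_3) (m11 m12 m21 m22 : R) :
  m11 * m22 - m12 * m21 = 1 -> 0 < p 0 1 ->
  iwasawa p = mx2 m11 m12 m21 m22 <->
  [/\ p 0 0 = (m11 * m21 + m12 * m22) * p 0 1,
      p 0 1 = (m21 ^+ 2 + m22 ^+ 2)^-1,
      sin (p 0 2) = - m21 * Num.sqrt (p 0 1) &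
      cos (p 0 2) = m22 * Num.sqrt (p 0 1)].
Proof.
move=> det1 y0; set r := Num.sqrt _.
have r0 : r != 0 by rewrite sqrtr_eq0 -ltNge.
have r2 : p 0 1 = r ^+ 2 by rewrite sqr_sqrtr// ltW.
rewrite iwasawaE -/r; split=> [/matrixP E|[xE yE sE cE]].
  have := E 0 0; have := E 0 1; have := E 1 0; have := E 1 1.
  rewrite !mxE /= => <- <- <- <-; rewrite r2.
  have sc := cos2Dsin2 (p 0 2).
  split.
  - transitivity (p 0 0 * (cos (p 0 2) ^+ 2 + sin (p 0 2) ^+ 2)).
      by rewrite sc mulr1.
    by field.
  - transitivity ((r ^- 2 * (cos (p 0 2) ^+ 2 + sin (p 0 2) ^+ 2))^-1).
      by rewrite sc mulr1 invrK.
    by congr (_ ^-1); field.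
  - by field.
  - by field.
have yd : p 0 1 * (m21 ^+ 2 + m22 ^+ 2) = 1.
  by rewrite yE mulVf// -invr_eq0 -yE gt_eqF.
rewrite sE cE xE; congr mx2.
- transitivity (r ^+ 2 * (m22 * 1 + (m11 * m21 + m12 * m22) * m21)).
    by rewrite r2; field.
  by rewrite -det1 -r2 -[RHS]mulr1 -yd; ring.
- transitivity (r ^+ 2 * (- m21 * 1 + (m11 * m21 + m12 * m22) * m22)).
    by rewrite r2; field.
  by rewrite -det1 -r2 -[RHS]mulr1 -yd; ring.
- by field.
- by field.
Qed.

(** * The one-parameter subgroup of a nilpotent element *)

Section NilpotentCurve.
Variables (R : realType) (A B c : R).
Hypotheses (ABc : A * B = - c ^+ 2).
Implicit Types t : R.

Definition nil_den (t : R) : R := B ^+ 2 * t ^+ 2 + (1 - c * t) ^+ 2.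
Definition nil_x (t : R) : R := ((A + B) * t + c * (B - A) * t ^+ 2) / nil_den t.
Definition nil_y (t : R) : R := (nil_den t)^-1.
(** The components of the velocity in the frame, as [lift_frameSL] shows. *)
Definition nil_u3 : R := (A - B) / 2.
Definition nil_u1 (t : R) : R := nil_u3 + B * nil_y t.
Definition nil_u2 (t : R) : R := (c + (A - B) * B * t) * nil_y t.

Lemma nil_c0 : B = 0 -> c = 0.
Proof.
move=> B0; move: ABc; rewrite B0 mulr0 => /esym/eqP.
by rewrite oppr_eq0 sqrf_eq0 => /eqP.
Qed.

Lemma nil_den_gt0 t : 0 < nil_den t.
Proof.
rewrite /nil_den -exprMn lt0r addr_ge0 ?sqr_ge0// andbT.
rewrite paddr_eq0 ?sqr_ge0// !sqrf_eq0 mulf_eq0.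
apply/negP => /andP[/orP[/eqP B0|/eqP ->]]; last by rewrite mulr0 subr0 oner_eq0.
by rewrite nil_c0// mul0r subr0 oner_eq0.
Qed.

Lemma nil_den_neq0 t : nil_den t != 0. Proof. by rewrite gt_eqF ?nil_den_gt0. Qed.
Lemma nil_y_gt0 t : 0 < nil_y t. Proof. by rewrite invr_gt0 nil_den_gt0. Qed.

(** Trading c ^ 2 t ^ 2 for - A B t ^ 2 leaves no c ^ 2, so that identities
    modulo A B = - c ^ 2 become polynomial identities. *)
Lemma nil_denE t : nil_den t = B * (B - A) * t ^+ 2 - 2 * c * t + 1.
Proof.
have -> : B * (B - A) * t ^+ 2 - 2 * c * t + 1 =
  B ^+ 2 * t ^+ 2 + - (A * B) * t ^+ 2 - 2 * c * t + 1 by ring.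
by rewrite ABc /nil_den; ring.
Qed.

Lemma is_derive_nil_y t : is_derive t 1 nil_y (2 * nil_y t * nil_u2 t).
Proof.
have dd : is_derive t 1 nil_den (2 * B * (B - A) * t - 2 * c).
  have -> : nil_den = horner ((B * (B - A)) *: 'X^2 - (2 * c) *: 'X + 1).
    by apply: funext => s; rewrite nil_denE !hornerE; ring.
  by apply: is_derive_eq; rewrite !poly.derivE !hornerE; ring.
have /is_derive_eq := is_derive_inv dd (nil_den_neq0 t).
by apply; rewrite /nil_u2 /nil_y; field; rewrite nil_den_neq0.
Qed.

Lemma is_derive_nil_u1 t : is_derive t 1 nil_u1 (2 * B * nil_y t * nil_u2 t).
Proof.
have /is_derive_eq := is_derive_add (is_derive_cst (nil_u3 : R) t 1)
  (is_derive_mul (is_derive_cst (B : R) t 1) (is_derive_nil_y t)).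
by apply; rewrite /cst; ring.
Qed.

(** The projection runs at the constant speed |u3|. *)
Lemma sqr_nil_u12 t : nil_u1 t ^+ 2 + nil_u2 t ^+ 2 = nil_u3 ^+ 2.
Proof.
have dE := nil_denE t; have d0 := nil_den_neq0 t.
rewrite /nil_u1 /nil_u2 /nil_y; move: dE d0; set d := nil_den t => dE d0.
apply: (@mulfI _ (d ^+ 2)); first by rewrite expf_neq0.
transitivity (nil_u3 ^+ 2 * d ^+ 2 + 2 * nil_u3 * B * d + B ^+ 2 +
   (c + (A - B) * B * t) ^+ 2); first by field.
have -> : (c + (A - B) * B * t) ^+ 2 =
  c ^+ 2 + (A - B) * B * (2 * c * t + (A - B) * B * t ^+ 2) by ring.
have -> : c ^+ 2 = - (A * B) by rewrite ABc opprK.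
by rewrite dE /nil_u3; field.
Qed.

Lemma is_derive_nil_u2 t : is_derive t 1 nil_u2 (- 2 * B * nil_y t * nil_u1 t).
Proof.
have /is_derive_eq :=
  is_derive_mul (is_derive_affine c ((A - B) * B) t) (is_derive_nil_y t).
apply.
transitivity ((A - B) * B * nil_y t + 2 * nil_u2 t ^+ 2).
  by rewrite /nil_u2; ring.
have -> : nil_u2 t ^+ 2 = nil_u3 ^+ 2 - nil_u1 t ^+ 2.
  by rewrite -(sqr_nil_u12 t); ring.
by rewrite /nil_u1 /nil_u3; field.
Qed.

Lemma is_derive_nil_x t : is_derive t 1 nil_x (2 * nil_y t * nil_u1 t).
Proof.
have nd : is_derive t 1 (fun s => (A + B) * s + c * (B - A) * s ^+ 2)
    (A + B + 2 * c * (B - A) * t).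
  have -> : (fun s => (A + B) * s + c * (B - A) * s ^+ 2) =
      horner ((A + B) *: 'X + (c * (B - A)) *: 'X^2).
    by apply: funext => s; rewrite !hornerE; ring.
  by apply: is_derive_eq; rewrite !poly.derivE !hornerE; ring.
have /is_derive_eq := is_derive_mul nd (is_derive_nil_y t).
apply.
apply: (@mulfI _ (nil_den t ^+ 2)); first by rewrite expf_neq0 ?nil_den_neq0.
transitivity (2 * ((A + B) * t + c * (B - A) * t ^+ 2) * (c + (A - B) * B * t)
  + (A + B + 2 * c * (B - A) * t) * nil_den t).
  by rewrite /nil_u2 /nil_y; field; rewrite nil_den_neq0.
(* The two sides differ by a multiple of A B + c ^ 2. *)
transitivity (2 * nil_u3 * nil_den t + 2 * B
  + 2 * (A * B + c ^+ 2) * (A * t ^+ 2 + c * (B - A) * t ^+ 3)).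
  by rewrite /nil_den /nil_u3; field.
by rewrite ABc addNr mulr0 mul0r addr0 /nil_u1 /nil_y; field; rewrite nil_den_neq0.
Qed.

Definition nil_curve (t : R) : 'M[R]_2 :=
  mx2 (1 + c * t) (A * t) (B * t) (1 - c * t).

Lemma nil_curve_det t : (1 + c * t) * (1 - c * t) - (A * t) * (B * t) = 1.
Proof.
transitivity (1 - (A * B + c ^+ 2) * t ^+ 2); first by ring.
by rewrite ABc addNr mul0r subr0.
Qed.

(** The coordinates x and y of a lift are forced, and theta is forced up to a
    constant; hence so is the velocity. *)
Lemma lift_frameSL (k : R -> 'rV[R]_3) :
  (forall t, [/\ 0 < k t 0 1, iwasawa (k t) = nil_curve t & derivable k t 1]) ->
  forall t, [/\ k t 0 0 = nil_x t, k t 0 1 = nil_y t &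
                derive1 k t = frameSL (k t) (nil_u1 t) (nil_u2 t) nil_u3].
Proof.
move=> kP.
have kE t : [/\ k t 0 0 = nil_x t, k t 0 1 = nil_y t,
    sin (k t 0 2) = - (B * t) * Num.sqrt (nil_y t) &
    cos (k t 0 2) = (1 - c * t) * Num.sqrt (nil_y t)].
  have [k0 kI _] := kP t.
  have [/(_ kI)[xE yE sE cE] _] := iwasawaP (nil_curve_det t) k0.
  have yE' : k t 0 1 = nil_y t by rewrite yE exprMn.
  by rewrite -yE'; split=> //; rewrite xE yE' /nil_x /nil_y; congr (_ * _); ring.
move=> t; have [xE yE sE cE] := kE t; split=> //.
have kd : is_derive t 1 k (derive1 k t).
  by have [_ _ ?] := kP t; apply: DeriveDef; rewrite // derive1E.
have k'E i := derive1_is_derive ((is_derive_rV k t _).2 kd i).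
rewrite frameSLE; apply/rowP => i.
case: i => -[|[|[|//]]] hi.
- rewrite [RHS]mxE /= yE -(derive1_is_derive (is_derive_nil_x t)) -k'E.
  have -> : Ordinal hi = 0 by exact: val_inj.
  by congr derive1; apply: funext => s; have [<-] := kE s.
- rewrite [RHS]mxE /= yE -(derive1_is_derive (is_derive_nil_y t)) -k'E.
  have -> : Ordinal hi = 1 by exact: val_inj.
  by congr derive1; apply: funext => s; have [_ <-] := kE s.
rewrite [RHS]mxE /=; set i := Ordinal hi; set dth := derive1 k t 0 i.
have i2 : i = 2 by exact: val_inj.
have thd : is_derive t 1 (fun s => k s 0 2) dth.
  by rewrite -i2; exact: ((is_derive_rV k t _).2 kd i).
have cosd : is_derive t 1 (fun s => cos (k s 0 2)) (- sin (k t 0 2) * dth).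
  exact: is_derive1_comp.
have sind : is_derive t 1 (fun s => sin (k s 0 2)) (cos (k t 0 2) * dth).
  exact: is_derive1_comp.
(* (cos theta, sin theta) is positively proportional to (1 - c t, - B t); the
   derivative of the vanishing determinant of these two vectors gives theta'
   without differentiating the square root. *)
have [_] := is_derive_add (is_derive_mul (is_derive_affine 0 B t) cosd)
                          (is_derive_mul (is_derive_affine 1 (- c) t) sind).
have -> : (fun s => (0 + B * s) * cos (k s 0 2)
             + (1 + - c * s) * sin (k s 0 2)) = cst 0.
  by apply: funext => s; have [_ _ -> ->] := kE s; rewrite /cst; ring.
rewrite derive_cst sE cE; set r := Num.sqrt (nil_y t) => E.
have r0 : r != 0 by rewrite sqrtr_eq0 -ltNge nil_y_gt0.
have {}E : r * (B + dth * nil_den t) = 0 by rewrite [RHS]E /nil_den; ring.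
have /eqP := E; rewrite mulf_eq0 (negPf r0) /= addrC addr_eq0 => /eqP dE.
transitivity (dth * nil_den t / nil_den t); first by rewrite mulfK// nil_den_neq0.
by rewrite dE /nil_u1 /nil_y; ring.
Qed.

(** The point (1 - c t, - B t) runs along a line that misses the origin; its
    polar angle is the arctangent of the position relative to the foot of the
    perpendicular, normalized to vanish at t = 0.  For B = 0 the convention
    z / 0 = 0 makes this the constant 0, as it should be. *)
Definition nil_theta (t : R) : R :=
  atan (- c / B) - atan (((c ^+ 2 + B ^+ 2) * t - c) / B).

Lemma nil_theta_trig t :
  sin (nil_theta t) = - (B * t) * Num.sqrt (nil_y t) /\
  cos (nil_theta t) = (1 - c * t) * Num.sqrt (nil_y t).
Proof.
have [B0|B0] := eqVneq B 0.
  rewrite /nil_theta /nil_y /nil_den B0 (nil_c0 B0) !invr0 !mulr0 atan0 subrr.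
  rewrite sin0 cos0 !(mul0r, oppr0, addr0, expr0n, add0r, expr1n).
  by rewrite invr1 sqrtr1 mul1r.
rewrite /nil_theta sinB cosB !sin_atan !cos_atan /nil_y.
rewrite sqrtrV; last exact/ltW/nil_den_gt0.
set m := c ^+ 2 + B ^+ 2; set P := - c / B; set Q := (m * t - c) / B.
set rP := Num.sqrt (1 + P ^+ 2); set rQ := Num.sqrt (1 + Q ^+ 2).
have m0 : m != 0 by rewrite gt_eqF// ltr_wpDl ?sqr_ge0// exprn_even_gt0.
have den0 := nil_den_gt0 t.
(* 1 + P ^ 2 = m / B ^ 2 and 1 + Q ^ 2 = (m / B ^ 2) den, so the two square
   roots combine into a single one. *)
have PQ : rP * rQ = m / B ^+ 2 * Num.sqrt (nil_den t).
  rewrite -sqrtrM ?addr_ge0 ?ler01 ?sqr_ge0//.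
  have -> : (1 + P ^+ 2) * (1 + Q ^+ 2) = (m / B ^+ 2) ^+ 2 * nil_den t.
    by rewrite /P /Q /m /nil_den; field.
  rewrite sqrtrM ?sqr_ge0// sqrtr_sqr ger0_norm//.
  by rewrite divr_ge0 ?addr_ge0 ?sqr_ge0.
have s0 : Num.sqrt (nil_den t) != 0 by rewrite sqrtr_eq0 -ltNge.
have /andP[rP0 rQ0] : (rP != 0) && (rQ != 0).
  by rewrite -negb_or -mulf_eq0 PQ !mulf_neq0// invr_eq0 expf_neq0.
split.
- transitivity ((P - Q) / (rP * rQ)); first by field; rewrite ?rP0 ?rQ0.
  by rewrite PQ /P /Q; field; rewrite ?s0 ?m0 ?B0.
- transitivity ((1 + P * Q) / (rP * rQ)); first by field; rewrite ?rP0 ?rQ0.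
  by rewrite PQ /P /Q /m; field; rewrite ?s0 ?m0 ?B0.
Qed.

Definition nil_lift (t : R) : 'rV[R]_3 := vec3 (nil_x t) (nil_y t) (nil_theta t).

Lemma iwasawa_nil_lift t : iwasawa (nil_lift t) = nil_curve t.
Proof.
have [sE cE] := nil_theta_trig t.
apply/(iwasawaP (nil_curve_det t)); rewrite /nil_lift !mxE /=.
  exact: nil_y_gt0.
split=> //; last by rewrite /nil_y /nil_den exprMn.
by rewrite /nil_x /nil_y; congr (_ * _); ring.
Qed.

Lemma coord_lift_nil : coord_lift nil_curve nil_lift.
Proof.
have thd t : derivable nil_theta t 1.
  pose m := c ^+ 2 + B ^+ 2.
  have lE : (fun s => (m * s - c) / B) = fun s => - c / B + m / B * s.
    by apply: funext => s; ring.
  have := is_derive_affine (- c / B) (m / B) t; rewrite -lE => ld.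
  have := is_derive_add (is_derive_cst (atan (- c / B) : R) t 1)
    (is_deriveN (is_derive1_comp (is_derive1_atan _) ld)).
  by case.
have kder t : derivable nil_lift t 1.
  apply/derivable_mxP => i j; rewrite ord1.
  case: j => -[|[|[|//]]] hj; under eq_fun do rewrite mxE /=.
  - by have [] := is_derive_nil_x t.
  - by have [] := is_derive_nil_y t.
  - exact: thd.
have y0 t : 0 < nil_lift t 0 1 by rewrite mxE /= nil_y_gt0.
have kP t := And3 (y0 t) (iwasawa_nil_lift t) (kder t).
move=> t; split=> //; first exact: iwasawa_nil_lift.
apply: (covderiv_frameSL _ _ _ (is_derive_nil_u1 t)
  (is_derive_nil_u2 t) (is_derive_cst (nil_u3 : R) t 1)).1 => //.
  by rewrite gt_eqF.
by move=> s; have [] := lift_frameSL kP s.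
Qed.

Lemma coord_lift_frameSL k : coord_lift nil_curve k -> forall t,
  [/\ k t 0 1 != 0, k t 0 1 = nil_y t &
      derive1 k t = frameSL (k t) (nil_u1 t) (nil_u2 t) nil_u3].
Proof.
move=> kl t.
have kP s : [/\ 0 < k s 0 1, iwasawa (k s) = nil_curve s & derivable k s 1].
  by have [] := kl s.
have [y0 _ _] := kP t; have [_ yE k'E] := lift_frameSL kP t.
by rewrite gt_eqF.
Qed.

Lemma gnorm_lift k t : coord_lift nil_curve k ->
  Defs.gnorm (@gSL R) (k t) (derive1 k t) = Num.sqrt (2 * nil_u3 ^+ 2).
Proof.
move=> /coord_lift_frameSL/(_ t)[y0 _ k'E].
rewrite /Defs.gnorm k'E gSL_frameSL// -!expr2 sqr_nil_u12//.
by congr Num.sqrt; ring.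
Qed.

Lemma unit_speed_nil : unit_speed nil_curve <-> 2 * nil_u3 ^+ 2 = 1.
Proof.
split=> [[k kl /(_ 0)]|u31].
  rewrite gnorm_lift// => /(congr1 (fun r => r ^+ 2)).
  by rewrite expr1n sqr_sqrtr// mulr_ge0 ?sqr_ge0 ?ler0n.
exists nil_lift; first exact: coord_lift_nil.
by move=> t; rewrite gnorm_lift ?u31 ?sqrtr1//; exact: coord_lift_nil.
Qed.

Lemma contact_angle_nil (sigma : R) : 0 <= sigma <= pi -> cos sigma = nil_u3 ->
  contact_angle nil_curve (fun=> sigma).
Proof.
move=> sigma_pi sE; have kl := coord_lift_nil.
exists nil_lift => // t; split=> //.
have [y0 _ ->] := coord_lift_frameSL kl t.
by rewrite xi_frameSL gSL_frameSL// sE; ring.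
Qed.

(** The terms B y = u1 - u3 coming from u1' and u2' cancel the part u1 of the
    factor u1 + u3 in the connection, which leaves 4 u3 (- u2, u1, 0). *)
Lemma covderiv_lift k t : coord_lift nil_curve k ->
  covderiv (@gSL R) k (derive1 k) t = (4 * nil_u3) *: phi (k t) (derive1 k t).
Proof.
move=> kl; have [y0 yE k'E] := coord_lift_frameSL kl t.
have [_ _ kd _] := kl t.
have k'E' s : derive1 k s = frameSL (k s) (nil_u1 s) (nil_u2 s) nil_u3.
  by have [] := coord_lift_frameSL kl s.
rewrite (covderiv_frameSL y0 kd k'E' (is_derive_nil_u1 t) (is_derive_nil_u2 t)
  (is_derive_cst (nil_u3 : R) t 1)).2.
rewrite k'E phi_frameSL// !frameSLE; apply/rowP => i; rewrite !mxE yE.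
have BE : B * nil_y t = nil_u1 t - nil_u3 by rewrite /nil_u1 addrC addKr.
have -> : 2 * B * nil_y t * nil_u2 t = 2 * (B * nil_y t) * nil_u2 t by ring.
have -> : - 2 * B * nil_y t * nil_u1 t = - 2 * (B * nil_y t) * nil_u1 t by ring.
rewrite BE.
by case: i => -[|[|[|//]]] hi /=; ring.
Qed.

Lemma contact_magnetic_nil (q : R) : A != B ->
  contact_magnetic q nil_curve <-> q = 4 * nil_u3.
Proof.
move=> AB; split=> [[k kl /(_ 0)]|->]; last first.
  exists nil_lift; first exact: coord_lift_nil.
  by move=> t; rewrite covderiv_lift//; exact: coord_lift_nil.
have [y0 _ k'E] := coord_lift_frameSL kl 0.
rewrite covderiv_lift// => /eqP; rewrite -subr_eq0 -scalerBl scaler_eq0.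
case/orP => [|/eqP]; first by rewrite subr_eq0 => /eqP.
have -> : 0 = frameSL (k 0) 0 0 0 by rewrite /frameSL !scale0r !addr0.
rewrite k'E phi_frameSL// => /(frameSL_inj y0)[/eqP + u10 _].
rewrite oppr_eq0 => /eqP u20.
have := sqr_nil_u12 0; rewrite u10 u20 expr0n addr0 => /esym/eqP.
by rewrite sqrf_eq0 mulf_eq0 invr_eq0 pnatr_eq0 orbF subr_eq0 (negPf AB).
Qed.

Definition nil_proj (t : R) : 'rV[R]_2 := vec2 (nil_x t) (nil_y t).

Lemma projH_nil t : projH (nil_curve t) = nil_proj t.
Proof. by rewrite -(iwasawa_nil_lift) projH_iwasawa// nil_y_gt0. Qed.

Lemma is_derive_nil_proj t :
  is_derive t 1 nil_proj (vec2 (2 * nil_y t * nil_u1 t) (2 * nil_y t * nil_u2 t)).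
Proof.
apply/is_derive_rV => i.
case: i => -[|[|//]] hi; under eq_fun do rewrite mxE /=; rewrite mxE /=.
- exact: is_derive_nil_x.
- exact: is_derive_nil_y.
Qed.

(** The velocity has constant length |u3|, so the unit tangent is a constant
    multiple of it. *)
Lemma signed_curvature_nil : A != B ->
  signed_curvature nil_proj (fun=> 2 * Num.sg nil_u3).
Proof.
move=> AB; have u30 : nil_u3 != 0.
  by rewrite mulf_neq0 ?invr_eq0 ?pnatr_eq0 ?subr_eq0.
have yE t : nil_proj t 0 1 = nil_y t by rewrite mxE.
have y0 t : nil_y t != 0 by rewrite gt_eqF ?nil_y_gt0.
have bE t := derive1_is_derive (is_derive_nil_proj t).
have nE t : Defs.gnorm (@gH R) (nil_proj t) (derive1 nil_proj t) = `|nil_u3|.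
  by rewrite bE -yE gnorm_gH ?yE// sqr_nil_u12// sqrtr_sqr.
pose k := `|nil_u3|^-1.
have k0 : k != 0 by rewrite invr_eq0 normr_eq0.
have TE : unit_tangent nil_proj =
    fun t => vec2 (k * (2 * nil_y t * nil_u1 t)) (k * (2 * nil_y t * nil_u2 t)).
  apply: funext => t; rewrite /unit_tangent nE bE; apply/rowP => i.
  by rewrite !mxE; case: i => -[|[|//]].
have Td t : is_derive t 1 (unit_tangent nil_proj)
    (vec2 (k * (4 * nil_y t * nil_u2 t * nil_u1 t + 4 * B * nil_y t ^+ 2 * nil_u2 t))
          (k * (4 * nil_y t * nil_u2 t ^+ 2 - 4 * B * nil_y t ^+ 2 * nil_u1 t))).
  rewrite TE; apply/is_derive_rV => i.
  have yd := is_derive_mul (is_derive_cst (2 : R) t 1) (is_derive_nil_y t).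
  case: i => -[|[|//]] hi; under eq_fun do rewrite mxE /=; rewrite mxE /=.
  - have /is_derive_eq := is_derive_mul (is_derive_cst (k : R) t 1)
      (is_derive_mul yd (is_derive_nil_u1 t)).
    by apply; rewrite /cst; ring.
  - have /is_derive_eq := is_derive_mul (is_derive_cst (k : R) t 1)
      (is_derive_mul yd (is_derive_nil_u2 t)).
    by apply; rewrite /cst; ring.
move=> t; split.
- by rewrite yE nil_y_gt0.
- by case: (is_derive_nil_proj t).
- apply/negP => /eqP b0; have := nE t.
  rewrite b0 /Defs.gnorm /gH !mxE !mul0r addr0 mul0r sqrtr0 => /esym/eqP.
  by rewrite normr_eq0 (negPf u30).
- by case: (Td t).
- rewrite nE covderiv_gH ?yE// (derive1_is_derive (Td t)) bE TE.
  have sE : Num.sg nil_u3 = nil_u3 * k.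
    by rewrite {2}[nil_u3]numEsg mulfK// normr_eq0.
  rewrite sE /Jc.
  have BE : B * nil_y t = nil_u1 t - nil_u3 by rewrite /nil_u1 addrC addKr.
  apply/rowP => i; rewrite !mxE -/k.
  have -> : 4 * B * nil_y t ^+ 2 * nil_u2 t
    = 4 * (B * nil_y t) * nil_y t * nil_u2 t by ring.
  have -> : 4 * B * nil_y t ^+ 2 * nil_u1 t
    = 4 * (B * nil_y t) * nil_y t * nil_u1 t by ring.
  rewrite BE.
  by case: i => -[|[|//]] hi /=; field; rewrite ?y0 ?B0.
Qed.

Lemma range_nil_line : B = 0 -> A != 0 ->
  range nil_proj = [set z : 'rV[R]_2 | z 0 1 = 1].
Proof.
move=> B0 A0; have c0 := nil_c0 B0.
have nE t : nil_proj t = vec2 (A * t) 1.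
  have d1 : nil_den t = 1 by rewrite /nil_den B0 c0; ring.
  by rewrite /nil_proj /nil_x /nil_y d1 B0 c0; congr vec2; field.
apply/seteqP; split=> [z [t _ <-]|z /= z1]; first by rewrite nE /= mxE.
exists (z 0 0 / A) => //; rewrite nE; apply/rowP => i; rewrite mxE.
case: i => -[|[|//]] hi /=.
  by rewrite mulrC divfK//; congr (z 0 _); apply: val_inj.
by rewrite -z1; congr (z 0 _); apply: val_inj.
Qed.

(** The affine function w of t is the inverse slope (x - c / B) / y seen
    from the tangency point (c / B, 0); it parametrizes the circle without that point. *)
Lemma range_nil_circle : B != 0 ->
  range nil_proj = [set z : 'rV[R]_2 | 0 < z 0 1 /\
    (z 0 0 - c / B) ^+ 2 + (z 0 1 - (B - A) / (2 * B)) ^+ 2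
      = (B - A) ^+ 2 / (4 * B ^+ 2)].
Proof.
move=> B0.
have BA0 : B - A != 0.
  apply/eqP => BA; have AE : A = B by lra.
  have : 0 < B ^+ 2 by rewrite exprn_even_gt0.
  have := sqr_ge0 c; have := ABc; rewrite AE; lra.
pose w t := (B - A) * t - c / B.
have c2 : c ^+ 2 = - (A * B) by rewrite ABc opprK.
have xw t : nil_x t = c / B + nil_y t * w t.
  have d0 := nil_den_neq0 t; apply: (mulIf d0).
  rewrite /nil_x /nil_y divfK// [RHS]mulrDl (mulrC _ (w t)) divfK//.
  rewrite [in RHS]nil_denE.
  rewrite /w.
  transitivity (c * (B - A) * t ^+ 2 - 2 * c ^+ 2 / B * t + (B - A) * t);
    last by field.
  by rewrite c2; field.
have w2 t : w t ^+ 2 + 1 = (B - A) / B * nil_den t.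
  rewrite (nil_denE).
  transitivity ((B - A) ^+ 2 * t ^+ 2 - 2 * (B - A) * t * c / B
    + c ^+ 2 / B ^+ 2 + 1).
    by rewrite /w; field.
  by rewrite c2; field.
have circleE (x y : R) : 0 < y ->
  (x - c / B) ^+ 2 + (y - (B - A) / (2 * B)) ^+ 2 = (B - A) ^+ 2 / (4 * B ^+ 2)
  <-> ((x - c / B) / y) ^+ 2 + 1 = (B - A) / B / y.
  move=> y0; have {}y0 : y != 0 by rewrite gt_eqF.
  set X := x - c / B; split=> E.
    apply: (mulfI (expf_neq0 2 y0)).
    transitivity (X ^+ 2 + (y - (B - A) / (2 * B)) ^+ 2
       - (B - A) ^+ 2 / (4 * B ^+ 2) + (B - A) / B * y).
      by field; rewrite ?y0 ?B0.
    by rewrite E; field; rewrite ?y0 ?B0.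
  transitivity (y ^+ 2 * ((X / y) ^+ 2 + 1) - (B - A) / B * y
     + (B - A) ^+ 2 / (4 * B ^+ 2)); first by field; rewrite ?y0 ?B0.
  by rewrite E; field; rewrite ?y0 ?B0.
apply/seteqP; split=> [_ [t _ <-]|z /= [z0 /(circleE _ _ z0) zE]].
  have y0 := nil_y_gt0 t; rewrite /= !mxE /=; split=> //.
  apply/(circleE _ _ y0); rewrite xw [c / B + _]addrC addrK.
  by rewrite mulrAC divff ?gt_eqF// mul1r w2 /nil_y invrK.
have z1 : z 0 1 != 0 by rewrite gt_eqF.
pose t := ((z 0 0 - c / B) / z 0 1 + c / B) / (B - A).
have wE : w t = (z 0 0 - c / B) / z 0 1.
  by rewrite /w /t; field; rewrite ?z1 ?B0 ?BA0.
have yE : nil_y t = z 0 1.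
  apply: invr_inj; rewrite /nil_y invrK; apply: (@mulfI _ ((B - A) / B)).
    by rewrite mulf_neq0// invr_eq0.
  by rewrite -w2 wE zE.
exists t => //; apply/rowP => i; rewrite mxE.
case: i => -[|[|//]] hi /=.
  rewrite xw yE wE [z 0 1 * _]mulrC divfK// addrC subrK.
  by congr (z 0 _); apply: val_inj.
by rewrite yE; congr (z 0 _); apply: val_inj.
Qed.
End NilpotentCurve.


(** * The theorem *)

Lemma sl2_coordE (R : realType) (a b c : R) :
  a *: E1 R + b *: E2 R + c *: E3 R =
  mx2 c (Num.sqrt 2 * a) (Num.sqrt 2 * b) (- c).
Proof.
apply/matrixP => i j; rewrite !mxE.
by case: ifP => _; case: ifP => _; ring.
Qed.

Lemma det_mx2 (R : realType) (m11 m12 m21 m22 : R) :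
  \det (mx2 m11 m12 m21 m22) = m11 * m22 - m12 * m21.
Proof.
rewrite (expand_det_row _ 0) !big_ord_recl big_ord0 /cofactor !det_mx11 !mxE /=.
by ring.
Qed.

Lemma expmx_nil (R : realType) (A B c t : R) : A * B = - c ^+ 2 ->
  expmx (t *: mx2 c A B (- c)) = nil_curve A B c t.
Proof.
move=> ABc; rewrite expmx_sq0.
  apply/matrixP => i j; rewrite !mxE.
  by case: i => -[|[|//]] hi; case: j => -[|[|//]] hj /=; ring.
rewrite exprZn (expr2 (mx2 _ _ _ _)) -mulmxE; apply/matrixP => i j.
rewrite !mxE !big_ord_recl big_ord0 !mxE /=.
have AB0 u : u * (A * B + c ^+ 2) = 0 by rewrite ABc addNr mulr0.
by case: i => -[|[|//]] hi; case: j => -[|[|//]] hj /=;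
  [rewrite -[RHS](AB0 (t ^+ 2)) | | | rewrite -[RHS](AB0 (t ^+ 2))]; ring.
Qed.

Theorem mainTheorem3 (R : realType) (a b c : R) :
  let X : 'M[R]_2 := a *: E1 R + b *: E2 R + c *: E3 R in
  let gamma := fun t : R => expmx (t *: X) in
  let beta := fun t : R => projH (gamma t) in
  let s := Num.sg (a - b) in
  X != 0 -> \det X = 0 ->
  [/\ \det X = - (c ^+ 2 + 2 * a * b),
      (forall t : R,
         beta t 0 0 = Num.sqrt 2 * ((a + b) * t + c * (b - a) * t ^+ 2)
                      / (2 * b ^+ 2 * t ^+ 2 + (1 - c * t) ^+ 2) /\
         beta t 0 1 = 1 / (2 * b ^+ 2 * t ^+ 2 + (1 - c * t) ^+ 2)),
      horocycle (range beta) /\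
      (b = 0 ->
         c = 0 /\
         range beta = [set z : 'rV[R]_2 | 0 < z 0 1 /\ z 0 1 - 1 = 0]) /\
      (b != 0 ->
         range beta =
         [set z : 'rV[R]_2 | 0 < z 0 1 /\
            (z 0 0 - c / (b * Num.sqrt 2)) ^+ 2
            + (z 0 1 - (b - a) / (2 * b)) ^+ 2
            = (b - a) ^+ 2 / (4 * b ^+ 2)]),
      (unit_speed gamma <-> a ^+ 2 + b ^+ 2 + c ^+ 2 = 1) &
      (unit_speed gamma ->
         `|a - b| = 1 /\
         exists sigma : R,
           [/\ contact_angle gamma (fun=> sigma),
               sigma = pi / 4 \/ sigma = 3 * pi / 4,
               (forall q : R, q != 0 ->
                  (contact_magnetic q gamma <-> q = 2 * Num.sqrt 2 * s)),
               (forall q : R, q = 2 * Num.sqrt 2 * s ->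
                  q - 2 * cos sigma = Num.sqrt 2 * s) &
               signed_curvature beta (fun=> 2 * s)])].
Proof.
move=> X gamma beta s X0 detX.
pose r : R := Num.sqrt 2; pose A := r * a; pose B := r * b.
have r2 : r ^+ 2 = 2 by rewrite sqr_sqrtr ?ler0n.
have r_gt0 : 0 < r by rewrite sqrtr_gt0 ltr0n.
have r0 : r != 0 by rewrite gt_eqF.
have XE : X = mx2 c A B (- c) by exact: sl2_coordE.
have abE : A * B = 2 * a * b by rewrite -r2 /A /B; ring.
have detE : \det X = - (c ^+ 2 + 2 * a * b) by rewrite XE det_mx2 abE; ring.
have abc : 2 * a * b = - c ^+ 2 by move: detX; rewrite detE; lra.
have ABc : A * B = - c ^+ 2 by rewrite abE.
have gE : gamma = nil_curve A B c.
  by apply: funext => t; rewrite /gamma XE expmx_nil.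
have bE : beta = nil_proj A B c.
  by apply: funext => t; rewrite /beta gE projH_nil.
have ab0 : a != b.
  apply: contraNneq X0 => ab; have a2 : 0 <= a ^+ 2 := sqr_ge0 _.
  have c2 := sqr_ge0 c; have /eqP : c ^+ 2 = 0 by move: abc; rewrite -ab; lra.
  have /eqP : a ^+ 2 = 0 by move: abc; rewrite -ab; lra.
  rewrite !sqrf_eq0 XE /A /B -ab => /eqP -> /eqP ->.
  by apply/eqP/matrixP => i j; rewrite !mxE mulr0 oppr0; do 2 case: ifP.
have AB0 : A != B by rewrite (inj_eq (mulfI r0)).
have u3E : nil_u3 A B = r / 2 * (a - b) by rewrite /nil_u3 /A /B; ring.
have u32 : 2 * nil_u3 A B ^+ 2 = a ^+ 2 + b ^+ 2 + c ^+ 2.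
  rewrite u3E !exprMn r2.
  have -> : c ^+ 2 = - (2 * a * b) by rewrite abc opprK.
  by field.
have denE t : nil_den B c t = 2 * b ^+ 2 * t ^+ 2 + (1 - c * t) ^+ 2.
  by rewrite /nil_den /B exprMn r2.
have lineE : b = 0 -> c = 0 /\ range beta = [set z : 'rV[R]_2 | z 0 1 = 1].
  move=> b0; have B0 : B = 0 by rewrite /B b0 mulr0.
  split; first exact: nil_c0 ABc B0.
  by rewrite bE range_nil_line// -B0.
have circleE : b != 0 -> range beta = [set z : 'rV[R]_2 | 0 < z 0 1 /\
    (z 0 0 - c / (b * r)) ^+ 2 + (z 0 1 - (b - a) / (2 * b)) ^+ 2
    = (b - a) ^+ 2 / (4 * b ^+ 2)].
  move=> b0; rewrite bE range_nil_circle ?mulf_neq0//.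
  have -> : c / B = c / (b * r) by rewrite [b * r]mulrC.
  have -> : (B - A) / (2 * B) = (b - a) / (2 * b).
    by rewrite /A /B; field; rewrite ?r0 ?b0.
  have -> // : (B - A) ^+ 2 / (4 * B ^+ 2) = (b - a) ^+ 2 / (4 * b ^+ 2).
  by rewrite /A /B; field; rewrite ?r0 ?b0.
split=> //.
- move=> t; rewrite bE !mxE /= /nil_x /nil_y denE div1r; split=> //.
  by congr (_ / _); rewrite -/r /A /B; ring.
- split; last first.
    split=> // b0; have [c0 ->] := lineE b0; split=> //.
    apply/seteqP; split=> z /=; first by move=> ->; rewrite subrr ltr01.
    by move=> [_ /eqP]; rewrite subr_eq0 => /eqP.
  have [b0|b0] := eqVneq b 0.
    by left; exists 1 => //; have [] := lineE b0.
  right; exists (c / (b * r)), ((b - a) / (2 * b)); split.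
    have -> : (b - a) / (2 * b) = (b ^+ 2 + c ^+ 2 / 2) / (2 * b ^+ 2).
      have -> : c ^+ 2 = - (2 * a * b) by rewrite abc opprK.
      by field.
    have b2 : 0 < b ^+ 2 by rewrite exprn_even_gt0.
    apply: divr_gt0; last by rewrite mulr_gt0.
    by apply: ltr_pwDl; rewrite // divr_ge0 ?sqr_ge0.
  rewrite circleE//; apply/seteqP; split=> z /= [z0 zE]; split=> //; rewrite zE;
    by field.
- by rewrite gE unit_speed_nil// u32.
- rewrite gE unit_speed_nil// u32 => abc1.
  have ab1 : `|a - b| = 1.
    apply/eqP; rewrite -sqrp_eq1// real_normK ?num_real//.
    by apply/eqP; rewrite -abc1 -u32 u3E !exprMn r2; field.
  have sE : a - b = s by rewrite [LHS]numEsg ab1 mulr1.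
  split=> //; rewrite bE.
  have pi0 := pi_gt0 R.
  have [sigma [sigma_pi sigma4 cosE]] : exists sigma : R,
      [/\ 0 <= sigma <= pi, sigma = pi / 4 \/ sigma = 3 * pi / 4 &
          cos sigma = nil_u3 A B].
    have := ab0; rewrite u3E -subr_eq0 neq_lt => /orP[] ab.
      exists (3 * pi / 4); split; [lra|by right|].
      have -> : a - b = -1 by rewrite sE; exact: ltr0_sg.
      have -> : 3 * pi / 4 = - (pi / 4) + pi :> R by field.
      by rewrite cosDpi cosN cos_piquarter mulrN1.
    exists (pi / 4); split; [lra|by left|].
    have -> : a - b = 1 by rewrite sE; exact: gtr0_sg.
    by rewrite cos_piquarter mulr1.
  exists sigma; split=> //.
  + exact: contact_angle_nil.
  + move=> q _; rewrite contact_magnetic_nil// u3E sE.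
    by have -> : 4 * (r / 2 * s) = 2 * Num.sqrt 2 * s by rewrite /r; field.
  + by move=> q ->; rewrite cosE u3E sE /r; field.
  + have := signed_curvature_nil ABc AB0.
    by rewrite u3E sgrM gtr0_sg ?mul1r// divr_gt0// ltr0n.
Qed.
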